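(* Let $X$ be a Banach space, and suppose that the function $u:[0,T]\to X$ is analytic. Let $0=t_0<t_1<\dots<t_N=T$, $t_n=nk$, be a partition of the interval $[0,T]$. For each positive integer $m$ (and each $n$ such that all the nodes involved belong to $\{t_0,\dots,t_N\}$), we have $$D_+^mu(t_n)=u^{(m)}(t_n)+\sum_{i=m+1}^{\infty}\frac{k^{i-m}}{i!}u^{(i)}(t_n)\sum_{j=0}^{m}(-1)^j\binom{m}{j}(m-j)^i,$$ $$D_-^mu(t_n)=u^{(m)}(t_n)+\sum_{i=m+1}^{\infty}\frac{k^{i-m}}{i!}u^{(i)}(t_n)\sum_{j=0}^{m}(-1)^j\binom{m}{j}(-j)^i,$$ $$D_-(D_+D_-)^mu(t_n)=u^{(2m+1)}(t_n)+\sum_{i=2m+2}^{\infty}\frac{k^{i-2m-1}}{i!}u^{(i)}(t_n)\sum_{j=0}^{2m+1}(-1)^j\binom{2m+1}{j}(m-j)^i,$$ $$(D_+D_-)^mu(t_n)=u^{(2m)}(t_n)+\sum_{i=m+1}^{\infty}\frac{k^{2i-2m}}{(2i)!}u^{(2i)}(t_n)\sum_{j=0}^{2m}(-1)^j\binom{2m}{j}(m-j)^{2i},$$ $$D(D_+D_-)^mu(t_{n+1/2})=u^{(2m+1)}(t_{n+1/2})+\sum_{i=m+1}^{\infty}\frac{k^{2i-2m}}{(2i+1)!}u^{(2i+1)}(t_{n+1/2})\sum_{j=0}^{2m+1}(-1)^j\binom{2m+1}{j}\left(m-j+\tfrac12\right)^{2i+1},$$ and $$(D_+D_-)^mEu(t_{n+1/2})=u^{(2m)}(t_{n+1/2})+\sum_{i=m+1}^{\infty}a_{mi}\frac{k^{2i-2m}}{(2i)!}u^{(2i)}(t_{n+1/2}),$$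 where $$a_{mi}=\frac12\sum_{j=0}^{2m}(-1)^j\binom{2m}{j}\left[\left(m-j+\tfrac12\right)^{2i}+\left(m-j-\tfrac12\right)^{2i}\right].$$
   Context: Notation: $k>0$ is the spacing, $t_n=nk$, $t_{n+1/2}=(n+1/2)k$. The finite difference and average operators are $D_+v(t_n)=\frac{v(t_{n+1})-v(t_n)}{k}$, $D_-v(t_n)=\frac{v(t_n)-v(t_{n-1})}{k}$, $Dv(t_{n+1/2})=\frac{v(t_{n+1})-v(t_n)}{k}$, $Ev(t_{n+1/2})=\frac{v(t_{n+1})+v(t_n)}{2}$. Powers and composites of $D_+,D_-$ are defined recursively (they commute). $D(D_+D_-)^mu(t_{n+1/2})$ and $(D_+D_-)^mEu(t_{n+1/2})$ mean $D$, respectively $E$, applied to $v=(D_+D_-)^mu$, i.e. $\frac{1}{k}\left[(D_+D_-)^mu(t_{n+1})-(D_+D_-)^mu(t_n)\right]$ and $\frac12\left[(D_+D_-)^mu(t_{n+1})+(D_+D_-)^mu(t_n)\right]$. $u^{(i)}$ denotes the $i$-th derivative of $u$.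
   Formalization: Each formula is stated under the added condition that the Taylor series of u about the expansion point (t_n or t_{n+1/2}) converges at the nodes used; without it the claim fails, e.g. u(t)=1/(t²+1/4) on [0,1] with k=1, m=1, n=0, where the D_+ series diverges. *)

(* Defs.v *)
From mathcomp Require Import all_boot all_order all_algebra.
From mathcomp Require Import all_classical all_reals all_analysis.

Set Implicit Arguments.
Unset Strict Implicit.
Unset Printing Implicit Defensive.

Import Order.TTheory GRing.Theory Num.Theory.
Import numFieldNormedType.Exports.

Local Open Scope classical_set_scope.
Local Open Scope ring_scope.

Section Defs.
Context {R : realType} {X : completeNormedModType R}.
Implicit Types (A : set R) (u v : R -> X) (k t c x T : R).

(* A function [0, T] -> X is represented by a total function R -> X; everything
   below taken relatively to A = `[0, T] ignores the values outside of A, and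
   the derivatives are one-sided at 0 and T. *)
Definition derive_in A u t : X :=
  lim ((y - t)^-1 *: (u y - u t) @[y --> within A t^']).

Definition deriven_in A (i : nat) u : R -> X := iter i (derive_in A) u.

Definition analytic_on A u : Prop :=
  forall c, A c -> exists a : nat -> X,
    \forall t \near within A (nbhs c),
      series (fun i => (t - c) ^+ i *: a i) @ \oo --> u t.

Definition taylor_cvg A u c x : Prop :=
  cvgn (series (fun i => ((x - c) ^+ i / i`!%:R) *: deriven_in A i u c)).

Definition node k (n : nat) : R := n%:R * k.

Definition hnode k (n : nat) : R := (n%:R + 2^-1) * k.

(* Analyticity on [0, T] alone does not make the Taylor series about c converge
   at every node a finite difference uses (e.g. 1 / (t^2 + e^2) about 0 with
   k > e), and the infinite expansions then diverge. *)
Definition taylor_cvg_nodes T u k c (p q : nat) : Prop :=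
  forall l : nat, (p <= l <= q)%N -> taylor_cvg `[0, T] u c (node k l).

Definition Dplus k v : R -> X := fun t => k^-1 *: (v (t + k) - v t).

Definition Dminus k v : R -> X := fun t => k^-1 *: (v t - v (t - k)).

Definition Dmid k v : R -> X := fun t => k^-1 *: (v (t + k / 2) - v (t - k / 2)).

Definition Emid k v : R -> X := fun t => 2^-1 *: (v (t + k / 2) + v (t - k / 2)).

Definition Dpm k (m : nat) v : R -> X := iter m (fun w => Dplus k (Dminus k w)) v.

End Defs.

(* sum_(j = 0)^p (-1)^j binom(p, j) (s - j)^i *)
Definition altsum {R : realType} (p i : nat) (s : R) : R :=
  \sum_(0 <= j < p.+1) (-1) ^+ j * 'C(p, j)%:R * (s - j%:R) ^+ i.

(* Main.v *)
Require Import Defs.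
From mathcomp Require Import all_boot all_order all_algebra.
From mathcomp Require Import all_classical all_reals all_analysis.
From mathcomp Require Import ring lra zify.

(** The operators D_+, D_- and their composites are k^-p times a binomial
    alternating sum of p + 1 equidistant values of u, so expanding each value
    in its Taylor series about c and summing the finitely many series gives
    the coefficients [altsum p i s]; these vanish for i < p, equal p! for
    i = p, and vanish by the symmetry j -> p - j in the centred cases when
    p + i is odd.

    The analytic content is that a Taylor series about c which merely converges
    at a node x has sum u(x). Along the segment from c to x, the series converges
    normally up to x, and the identity theorem, obtained by recentring the power
    series, propagates its equality with u from c to every point before x; Abel's
    limit theorem and the continuity of u then give the equality at x. *)

Import Order.TTheory GRing.Theory Num.Theory.
Import numFieldNormedType.Exports.

Local Open Scope classical_set_scope.
Local Open Scope ring_scope.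

(** * Alternating binomial sums and finite differences *)

(** Pascal's rule splits each coefficient; reindexing one half pairs [f j] with [f j.+1]. *)
Lemma binomial_difference_recl (R : pzRingType) (V : lmodType R) (p : nat)
    (f : nat -> V) :
  \sum_(0 <= j < p.+2) ((-1) ^+ j * 'C(p.+1, j)%:R) *: f j =
  \sum_(0 <= j < p.+1) ((-1) ^+ j * 'C(p, j)%:R) *: (f j - f j.+1).
Proof.
rewrite big_nat_recl//= bin0.
under eq_bigr do rewrite binS natrD mulrDr scalerDl.
rewrite big_split/= big_nat_recr//= bin_small// mulr0 scale0r addr0.
under [in RHS]eq_bigr do rewrite scalerBr.
rewrite sumrB [in RHS]big_nat_recl//= bin0 addrA; congr (_ + _).
by rewrite -sumrN; apply: eq_bigr => j _; rewrite exprS mulN1r mulNr scaleNr.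
Qed.

Lemma binomial_difference_reclr (R : pzRingType) (p : nat) (f : nat -> R) :
  \sum_(0 <= j < p.+2) (-1) ^+ j * 'C(p.+1, j)%:R * f j =
  \sum_(0 <= j < p.+1) (-1) ^+ j * 'C(p, j)%:R * (f j - f j.+1).
Proof. exact: (@binomial_difference_recl R R^o). Qed.

(** One differencing gives [(s - j)^i - (s - j - 1)^i]; expanding the second power around [s - j]
    cancels the top degree, so only [l < i] remains. This degree drop drives the next two
    inductions. *)
Lemma altsumS (R : realType) (p i : nat) (s : R) :
  altsum p.+1 i s =
  \sum_(l < i) (- (-1) ^+ (i - l) * 'C(i, l)%:R) * altsum p l s.
Proof.
rewrite /altsum binomial_difference_reclr.
under [RHS]eq_bigr do rewrite mulr_sumr.
rewrite exchange_big/=; apply: eq_bigr => j _.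
have -> : s - j.+1%:R = -1 + (s - j%:R) by rewrite -natr1; ring.
rewrite [X in _ - X]exprDn big_ord_recr/= subnn expr0 mul1r binn mulr1n.
rewrite opprD addrCA subrr addr0 -sumrN mulr_sumr; apply: eq_bigr => l _.
by rewrite -mulr_natr; ring.
Qed.

Lemma altsum_small (R : realType) (p i : nat) (s : R) :
  (i < p)%N -> altsum p i s = 0.
Proof.
elim: p i => [//|p IHp] i ip; rewrite altsumS big1// => l _.
by rewrite IHp ?mulr0//; have := ltn_ord l; lia.
Qed.

(** In the recursion all degrees below [p] vanish, leaving [l = p] with coefficient [p + 1]. *)
Lemma altsum_diag (R : realType) (p : nat) (s : R) : altsum p p s = p`!%:R.
Proof.
elim: p => [|p IHp]; first by rewrite /altsum big_nat1 !expr0 bin0 !mulr1.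
rewrite altsumS big_ord_recr/= big1 => [|l _]; last first.
  by rewrite altsum_small ?mulr0.
by rewrite add0r IHp subSnn expr1 opprK mul1r binSn factS natrM.
Qed.

(** The substitution [j -> p - j] yields [(-1)^p] from the alternating signs and [(-1)^i] from the
    powers. *)
Lemma altsum_reflect (R : realType) (p i : nat) (s : R) :
  altsum p i (p%:R - s) = (-1) ^+ (p + i) * altsum p i s.
Proof.
rewrite /altsum big_nat_rev mulr_sumr/= !big_nat; apply: eq_bigr => j /andP[_ jp].
rewrite add0n subSS bin_sub// natrB//.
have -> : p%:R - s - (p%:R - j%:R) = -1 * (s - j%:R) by ring.
rewrite exprMn exprD; have -> : (-1) ^+ (p - j) = (-1) ^+ p * (-1) ^+ j :> R.
  by rewrite -exprD -signr_odd -[RHS]signr_odd oddB// oddD.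
by ring.
Qed.

(** The point [p / 2] is fixed by the reflection, so the sum equals its own negative. *)
Lemma altsum_parity {R : realType} (p i : nat) :
  odd (p + i) -> altsum p i (p%:R / 2) = 0 :> R.
Proof.
move=> opi; have := @altsum_reflect R p i (p%:R / 2).
rewrite -signr_odd opi expr1 (_ : p%:R - p%:R / 2 = p%:R / 2); last by field.
by move=> ?; lra.
Qed.

(** Common form of all the operators. For [k > 0], [s] is the offset of the rightmost node from [c]
    in units of [k], so translating [c] only changes [s]. *)
Definition fdiff {R : realType} {X : completeNormedModType R} (k : R) (p : nat)
    (s : R) (u : R -> X) (c : R) : X :=
  k ^- p *: \sum_(0 <= j < p.+1)
    ((-1) ^+ j * 'C(p, j)%:R) *: u (c + (s - j%:R) * k).

Section FiniteDifferences.
Context (R : realType) (X : completeNormedModType R) (k : R).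
Implicit Types (u : R -> X) (c s : R).

Lemma fdiff_shift p s x u c : fdiff k p s u (c + x * k) = fdiff k p (s + x) u c.
Proof.
congr (_ *: _); apply: eq_bigr => j _; congr (_ *: u _); ring.
Qed.

Lemma iter_Dplus p u c : iter p (Dplus k) u c = fdiff k p p%:R u c.
Proof.
elim: p u => [|p IHp] u.
  by rewrite /fdiff/= big_nat1 expr0 invr1 !scale1r bin0 mulr1 scale1r subrr mul0r addr0.
rewrite iterSr IHp /fdiff binomial_difference_recl exprSr invfM -scalerA.
congr (_ *: _); rewrite scaler_sumr; apply: eq_bigr => j _.
rewrite /Dplus !scalerA (mulrC k^-1) -!scalerA.
by congr (_ *: (_ *: (_ *: (u _ - u _)))); rewrite -!natr1; ring.
Qed.

Lemma Dminus_Dplus u c : Dminus k u c = Dplus k u (c - k).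
Proof. by rewrite /Dplus subrK. Qed.

Lemma iter_Dminus m u c : iter m (Dminus k) u c = fdiff k m 0 u c.
Proof.
suff -> : iter m (Dminus k) u c = iter m (Dplus k) u (c + - m%:R * k).
  by rewrite iter_Dplus fdiff_shift subrr.
elim: m c => [|m IHm] c; first by rewrite oppr0 mul0r addr0.
rewrite !iterS; move: IHm; set v := iter m (Dplus k) u => IHm.
by rewrite /Dminus !IHm /Dplus; congr (_ *: (v _ - v _)); rewrite -natr1; ring.
Qed.

(** [D_-] is [D_+] translated by [-k], and [D_+] commutes with translations, so each factor
    [D_+ D_-] contributes one shift by [-k]. *)
Lemma Dpm_shift m u c : Dpm k m u c = iter (2 * m) (Dplus k) u (c + - m%:R * k).
Proof.
elim: m c => [|m IHm] c; first by rewrite oppr0 mul0r addr0.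
rewrite {1}/Dpm iterS -/(Dpm k m u) mulnS !iterS.
move: IHm; set v := iter (2 * m) (Dplus k) u => IHm.
rewrite {1}/Dplus /Dminus !IHm /Dplus.
by congr (_ *: (_ *: (v _ - v _) - _ *: (v _ - v _))); rewrite -natr1; ring.
Qed.

Lemma Dplus_Dpm m u c : Dplus k (Dpm k m u) c =
  fdiff k (2 * m + 1) (m%:R + 1) u c.
Proof.
have -> : m%:R + 1 = (2 * m + 1)%:R + - m%:R :> R by rewrite natrD natrM; ring.
rewrite -fdiff_shift -iter_Dplus addn1 iterS {1}/Dplus !Dpm_shift.
set v := iter (2 * m) (Dplus k) u.
by rewrite /Dplus; congr (_ *: (v _ - v _)); ring.
Qed.

Lemma Dpm_fdiff m u c : Dpm k m u c = fdiff k (2 * m) m%:R u c.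
Proof.
by rewrite Dpm_shift iter_Dplus fdiff_shift natrM; congr (fdiff k (2 * m) _ u c); ring.
Qed.

Lemma Dminus_Dpm m u c : Dminus k (Dpm k m u) c = fdiff k (2 * m + 1) m%:R u c.
Proof.
rewrite Dminus_Dplus Dplus_Dpm -mulN1r fdiff_shift.
by congr (fdiff k (2 * m + 1) _ u c); ring.
Qed.

Lemma Dmid_Dpm m u c :
  Dmid k (Dpm k m u) c = fdiff k (2 * m + 1) (m%:R + 2^-1) u c.
Proof.
have -> : Dmid k (Dpm k m u) c = Dplus k (Dpm k m u) (c + - 2^-1 * k).
  by rewrite /Dmid /Dplus; congr (_ *: (Dpm _ _ _ _ - Dpm _ _ _ _)); field.
by rewrite Dplus_Dpm fdiff_shift; congr (fdiff k (2 * m + 1) _ u c); field.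
Qed.

Lemma Emid_Dpm m u c :
  Emid k (Dpm k m u) c = 2^-1 *: (fdiff k (2 * m) (m%:R + 2^-1) u c +
                                  fdiff k (2 * m) (m%:R - 2^-1) u c).
Proof.
rewrite -!fdiff_shift -!Dpm_fdiff /Emid; congr (_ *: (Dpm _ _ _ _ + Dpm _ _ _ _)).
  by ring.
by ring.
Qed.

End FiniteDifferences.

(** * Power series with coefficients in a Banach space *)

(** Terms with [j > i] have a zero binomial coefficient, so one range [K] serves all exponents below
    it. *)
Lemma expr_binomial (R : comNzRingType) (s h : R) (i K : nat) : (i < K)%N ->
  (s + h) ^+ i = \sum_(0 <= j < K) 'C(i, j)%:R * s ^+ (i - j) * h ^+ j.
Proof.
move=> iK; rewrite exprDn (@big_cat_nat _ _ _ i.+1)//= [X in _ + X]big_nat.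
rewrite [X in _ + X]big1 => [|j /andP[ij _]]; last by rewrite bin_small ?mul0r.
rewrite addr0 big_mkord; apply: eq_bigr => j _.
by rewrite -mulr_natl mulrA.
Qed.

Lemma binomial_term_le (R : realDomainType) (s h : R) (i j : nat) :
  0 <= s -> 0 <= h -> 'C(i, j)%:R * s ^+ (i - j) * h ^+ j <= (s + h) ^+ i.
Proof.
move=> s0 h0; have [ij|ji] := ltnP i j.
  by rewrite bin_small// !mul0r exprn_ge0// addr_ge0.
rewrite (expr_binomial _ _ _ _ i.+1)// (bigD1_seq j) ?iota_uniq//=.
  by rewrite lerDl sumr_ge0// => l _; rewrite !mulr_ge0 ?exprn_ge0.
by rewrite mem_index_iota.
Qed.

Lemma binomial_tail_le (R : realDomainType) (s h : R) (i n : nat) :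
  `|(s + h) ^+ i - \sum_(0 <= j < n) 'C(i, j)%:R * s ^+ (i - j) * h ^+ j|
  <= (`|s| + `|h|) ^+ i.
Proof.
(* This range exceeds [i] and contains [n], so it can be cut at [n] whichever of the two is
   larger. *)
have iK : (i < i.+1 + n)%N by lia.
rewrite !(expr_binomial _ _ _ _ _ iK).
rewrite [X in X - _](@big_cat_nat _ _ _ n)//=; last by lia.
rewrite addrAC subrr add0r (le_trans (ler_norm_sum _ _ _))//.
rewrite [leRHS](@big_cat_nat _ _ _ n)//=; last by lia.
rewrite ler_wpDl//.
  by rewrite sumr_ge0// => l _; rewrite !mulr_ge0 ?exprn_ge0.
by apply: ler_sum => j _; rewrite !normrM !normrX normr_nat.
Qed.

Lemma cvg_ge0_series_tail {R : realType} (v : nat -> R) :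
  (forall i, 0 <= v i) -> cvgn (series v) ->
  forall e : R, 0 < e -> exists N, forall m n, (N <= m)%N ->
    \sum_(m <= i < n) v i <= e.
Proof.
move=> v0 cv e e0.
have nd : nondecreasing_seq (series v) by apply: nondecreasing_series.
have /cvgrPdist_le/(_ e e0)[N _ HN] := cv.
exists N => m n Nm; have [nm|mn] := leqP n m.
  by rewrite big_geq// ltW.
rewrite -(sub_series_geq _ (ltnW mn)).
have := HN _ Nm; rewrite ger0_norm ?subr_ge0; last exact: nondecreasing_cvgn_le.
by apply: le_trans; rewrite lerB//; exact: nondecreasing_cvgn_le.
Qed.

Section PowerSeries.
Context {R : realType} {X : completeNormedModType R}.
Implicit Types (a b : nat -> X) (r s h t : R) (l : X).

Definition powser a h : nat -> X := series (fun i => h ^+ i *: a i).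

(** For [r >= 0], normal convergence on the closed ball of radius [r], boundary included. *)
Definition normally_summable a r : Prop :=
  cvgn (series (fun i => `|a i| * r ^+ i)).

(** Coefficient of [h^j] when [sum a_i (s + h)^i] is rearranged in powers of [h]. For [i < j] the
    binomial coefficient is zero, so the truncated [i - j] is harmless. *)
Definition recenter a s (j : nat) : X :=
  limn (series (fun i => ('C(i, j)%:R * s ^+ (i - j)) *: a i)).

Lemma cvg_dist_le (v : nat -> X) l (b : X) (C : R) :
  v @ \oo --> l -> (\forall n \near \oo, `|v n - b| <= C) -> `|l - b| <= C.
Proof.
move=> vl vC; have c : `|v n - b| @[n --> \oo] --> `|l - b|.
  by apply: cvg_norm; apply: cvgB => //; exact: cvg_cst.
by rewrite -(cvg_lim _ c)//; apply: limr_le; [exact: cvgP c|].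
Qed.

Lemma normally_summable_cvg a r h :
  normally_summable a r -> `|h| <= r -> cvgn (powser a h).
Proof.
move=> ar hr; apply: normed_cvg; apply: series_le_cvg ar => i//=.
  by rewrite mulr_ge0// exprn_ge0// (le_trans _ hr).
by rewrite normrZ normrX mulrC ler_wpM2l// lerXn2r ?nnegrE// (le_trans _ hr).
Qed.

(** The terms at [h] are bounded, so those at [r] are dominated by a geometric series of ratio
    [r / |h| < 1]. *)
Lemma powser_normally_summable a h r :
  cvgn (powser a h) -> 0 <= r -> r < `|h| -> normally_summable a r.
Proof.
move=> ah r0 rh; have h0 : 0 < `|h| by exact: le_lt_trans rh.
have /cvg_seq_bounded[K [_ /(_ (K + 1))]] : cvgn (fun i => h ^+ i *: a i).
  by apply/cvg_ex; exists 0; exact: cvg_series_cvg_0.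
rewrite ltrDl ltr01 => /(_ isT) bnd.
apply: (@series_le_cvg _ _ (geometric (K + 1) (r / `|h|))) => [i|i|i|].
- by rewrite mulr_ge0// exprn_ge0.
- rewrite /= mulr_ge0 ?exprn_ge0 ?divr_ge0//.
  by rewrite (le_trans _ (bnd i _)).
- rewrite /= expr_div_n mulrA ler_pdivlMr ?exprn_gt0// mulrAC ler_wpM2r ?exprn_ge0//.
  by have := bnd i I; rewrite /= normrZ normrX mulrC.
- by apply: is_cvg_geometric_series; rewrite ger0_norm ?divr_ge0// ltr_pdivrMr// mul1r.
Qed.

Lemma normally_summable_le a r s :
  0 <= s -> s <= r -> normally_summable a r -> normally_summable a s.
Proof.
move=> s0 sr; apply: series_le_cvg => i.
- by rewrite mulr_ge0// exprn_ge0.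
- by rewrite mulr_ge0// exprn_ge0// (le_trans _ sr).
- by rewrite ler_wpM2l// lerXn2r ?nnegrE// (le_trans _ sr).
Qed.

(** [binomial_term_le] with [h = r - |s|] bounds the factor of [a i] by [r^i / (r - |s|)^j]. *)
Lemma recenter_cvg a r s j : normally_summable a r -> `|s| < r ->
  series (fun i => ('C(i, j)%:R * s ^+ (i - j)) *: a i) @ \oo --> recenter a s j.
Proof.
move=> ar sr; have rs : 0 < r - `|s| by rewrite subr_gt0.
have r0 : 0 <= r by rewrite ltW// (le_lt_trans _ sr).
suff : cvgn (series (fun i => ('C(i, j)%:R * s ^+ (i - j)) *: a i)) by [].
apply: normed_cvg.
apply: (@series_le_cvg _ _ (fun i => `|a i| * r ^+ i * (r - `|s|) ^- j)) => //=.
- by move=> i; rewrite !mulr_ge0 ?invr_ge0 ?exprn_ge0 ?(ltW rs).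
- move=> i; rewrite normrZ mulrC -mulrA ler_wpM2l//.
  rewrite ler_pdivlMr ?exprn_gt0// normrM normrX normr_nat.
  apply: le_trans (binomial_term_le _ _ _ _ _ _ (ltW rs)) _ => //.
  by rewrite addrC subrK.
- by rewrite (_ : (fun _ => _) = (r - `|s|) ^- j *: (fun i => `|a i| * r ^+ i));
    [exact: is_cvg_seriesZ|apply/funext => i; rewrite mulrC].
Qed.

(** As [|s| + |h| <= r], the double series over [i] and [j] converges absolutely, so the order of
    summation can be exchanged; a tail estimate uniform in [M] justifies this. *)
Lemma recenter_powser a r s h l : normally_summable a r -> `|s| < r ->
  `|s| + `|h| <= r -> powser a (s + h) @ \oo --> l ->
  powser (recenter a s) h @ \oo --> l.
Proof.
move=> ar sr shr al; apply/cvgrPdist_le => e e0.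
have r0 : 0 <= r by rewrite ltW// (le_lt_trans _ sr).
have [|N HN] := cvg_ge0_series_tail (fun i => `|a i| * r ^+ i) _ ar _ e0.
  by move=> i; rewrite mulr_ge0// exprn_ge0.
near=> n.
(* The first [n] recentred coefficients are themselves limits over [M], so both sides can be
   compared at a common finite [M]. *)
have cn : (fun M => \sum_(0 <= j < n) h ^+ j *:
    series (fun i => ('C(i, j)%:R * s ^+ (i - j)) *: a i) M) @ \oo -->
    powser (recenter a s) h n.
  apply: cvg_big => [|j _]; first exact: add_continuous.
  by apply: cvgZl_tmp; exact: recenter_cvg ar sr.
rewrite -[X in `|X|]subr0.
apply: cvg_dist_le (cvgB al cn) _; near=> M.
rewrite subr0.
have -> : (powser a (s + h) - (fun M => \sum_(0 <= j < n) h ^+ j *: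
    series (fun i => ('C(i, j)%:R * s ^+ (i - j)) *: a i) M)) M =
  \sum_(0 <= i < M) ((s + h) ^+ i -
    \sum_(0 <= j < n) 'C(i, j)%:R * s ^+ (i - j) * h ^+ j) *: a i.
  rewrite fctE /powser /series/=.
  under [X in _ - X]eq_bigr do rewrite scaler_sumr.
  rewrite exchange_big -sumrB/=; apply: eq_bigr => i _.
  rewrite scalerBl scaler_suml; congr (_ - _); apply: eq_bigr => j _.
  by rewrite scalerA mulrC.
(* The coefficient of a_i is zero for i < n and at most r^i otherwise, so the
   error is bounded by the tail from n of the normally convergent series. *)
rewrite (@big_cat_nat _ _ _ n)//=; last by near: M; exact: nbhs_infty_ge.
rewrite big_nat big1 ?add0r => [|i /andP[_ ni]]; last first.
  by rewrite (expr_binomial _ _ _ _ _ ni) subrr scale0r.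
apply: le_trans (HN n M _); last by near: n; exact: nbhs_infty_ge.
rewrite (le_trans (ler_norm_sum _ _ _))//; apply: ler_sum => i _.
rewrite normrZ mulrC ler_wpM2l// (le_trans (binomial_tail_le _ _ _ _ _))//.
by rewrite lerXn2r ?nnegrE// addr_ge0.
Unshelve. all: by end_near. Qed.

End PowerSeries.

(** * Local power series expansions and their derivatives *)

Section Expansions.
Context {R : realType} {X : completeNormedModType R}.
Implicit Types (a b : nat -> X) (r s h t c : R) (l : X) (A : set R) (u : R -> X).

Lemma powserS a h n :
  powser a h n.+1 = a 0%N + h *: powser (fun i => a i.+1) h n.
Proof.
rewrite /powser /series/= big_nat_recl//= expr0 scale1r scaler_sumr.
by congr (_ + _); apply: eq_bigr => i _; rewrite scalerA exprS.
Qed.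

Lemma powser_behead a h l : h != 0 -> powser a h @ \oo --> l ->
  powser (fun i => a i.+1) h @ \oo --> h^-1 *: (l - a 0%N).
Proof.
move=> h0; rewrite -cvg_shiftS => al.
rewrite (_ : powser _ h = fun n => h^-1 *: (powser a h n.+1 - a 0%N)).
  by apply: cvgZl_tmp; apply: cvgB => //; exact: cvg_cst.
by apply/funext => n; rewrite powserS addrC addKr scalerA mulVf// scale1r.
Qed.

Lemma normally_summable_behead a r : 0 < r -> normally_summable a r ->
  normally_summable (fun i => a i.+1) r.
Proof.
move=> r0 /cvg_ex[/= l]; rewrite -cvg_shiftS => al.
apply/cvg_ex; exists (r^-1 * (l - `|a 0%N|)).
rewrite (_ : series _ = fun n =>
    r^-1 *: (series (fun i => `|a i| * r ^+ i) n.+1 - `|a 0%N|)).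
  by apply: cvgZl_tmp; apply: cvgB => //; exact: cvg_cst.
apply/funext => n; rewrite /series/= big_nat_recl//= expr0 mulr1 addrC addKr.
rewrite scaler_sumr; apply: eq_bigr => i _.
by rewrite exprS mulrCA /GRing.scale/= mulKf ?gt_eqF.
Qed.

(** Factoring [h] out of the series without its constant term leaves a sum of norm at most
    [K = sum |a_(i+1)| r^i]. This gives continuity at the centre and, applied to the shifted series,
    differentiability. *)
Lemma powser_center a r : 0 < r -> normally_summable a r ->
  exists2 K : R, 0 <= K & forall h l, `|h| <= r -> powser a h @ \oo --> l ->
    `|l - a 0%N| <= K * `|h|.
Proof.
move=> r0 /(normally_summable_behead _ _ r0) ar.
have nd : nondecreasing_seq (series (fun i => `|a i.+1| * r ^+ i)).
  by apply: nondecreasing_series => i _ _; rewrite mulr_ge0// exprn_ge0// ltW.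
set K := limn (series (fun i => `|a i.+1| * r ^+ i)).
have leK n : series (fun i => `|a i.+1| * r ^+ i) n <= K.
  exact: nondecreasing_cvgn_le.
exists K; first by have := leK 0%N; rewrite /series/= big_nil.
move=> h l hr; rewrite -cvg_shiftS => al.
apply: cvg_dist_le al _; near=> n.
rewrite /= powserS addrC addKr normrZ mulrC ler_wpM2r//.
apply: le_trans (leK n); rewrite (le_trans (ler_norm_sum _ _ _))//.
apply: ler_sum => i _; rewrite normrZ normrX mulrC ler_wpM2l//.
by rewrite lerXn2r ?nnegrE// ltW.
Unshelve. all: by end_near. Qed.

(** Values are compared only at points of [A], so an endpoint of an interval can serve as centre. *)
Definition expands A u c a r : Prop :=
  [/\ 0 < r, normally_summable a r &
    forall t, A t -> `|t - c| < r -> powser a (t - c) @ \oo --> u t].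

Lemma expands_center A u c a r : A c -> expands A u c a r -> u c = a 0%N.
Proof.
move=> Ac [r0 ar aru]; have [K _ HK] := powser_center _ _ r0 ar.
have := HK 0 (u c); rewrite normr0 mulr0 => /(_ (ltW r0)).
have := aru c Ac; rewrite subrr normr0 => /(_ r0) h /(_ h).
by rewrite normr_le0 subr_eq0 => /eqP.
Qed.

(** The difference quotient at [y] is the sum of [a 1 + (y - c) a 2 + ...], which tends to [a 1] by
    [powser_center]. *)
Lemma expands_derive_center A u c a r : ProperFilter (within A c^') -> A c ->
  expands A u c a r -> derive_in A u c = a 1%N.
Proof.
move=> PF Ac Aua; have [r0 ar aru] := Aua.
have [K K0 HK] := powser_center _ _ r0 (normally_summable_behead _ _ r0 ar).
apply: cvg_lim => //; apply/cvgrPdist_le => e e0.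
(* Within this distance [K |y - c| <= e]; [K + 1] keeps the divisor positive when [K = 0]. *)
have d0 : 0 < Num.min r (e / (K + 1)).
  by rewrite lt_min r0 divr_gt0// ltr_wpDl.
have : within A c^' (ball c (Num.min r (e / (K + 1)))).
  by apply: (filterS _ (dnbhs_ball c d0)) => y [yc _] _.
move=> near_c; near=> y.
have Ay : A y by near: y; exact: withinT.
have yc : y != c.
  by near: y; apply: (filterS _ (nbhs_dnbhs_neq c)) => y yc _.
have : ball c (Num.min r (e / (K + 1))) y by near: y.
rewrite /ball/= distrC lt_min => /andP[yr ye].
have yc0 : y - c != 0 by rewrite subr_eq0.
rewrite (expands_center _ _ _ _ _ Ac Aua) distrC.
apply: le_trans (HK _ _ (ltW yr) (powser_behead _ _ _ yc0 (aru y Ay yr))) _.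
rewrite (le_trans (ler_wpM2l K0 (ltW ye)))// mulrCA ger_pMr//.
by rewrite ler_pdivrMr ?mul1r ?lerDl// ltr_wpDl.
Unshelve. all: by end_near. Qed.

(** The recentred series converges at [r - |t - c|]; halving this radius makes the convergence
    normal. *)
Lemma expands_recenter A u c a r t : `|t - c| < r -> expands A u c a r ->
  expands A u t (recenter a (t - c)) ((r - `|t - c|) / 2).
Proof.
move=> tr [r0 ar aru]; have d0 : 0 < r - `|t - c| by rewrite subr_gt0.
split; first by rewrite divr_gt0.
  have : `|t - c| + `|r - `|t - c| | <= r by rewrite (gtr0_norm d0) addrC subrK.
  move=> hr; have cv : cvgn (powser a (t - c + (r - `|t - c|))).
    by apply: normally_summable_cvg ar _; rewrite (le_trans (ler_normD _ _)).
  apply: (@powser_normally_summable _ _ _ (r - `|t - c|)).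
  - exact: cvgP (recenter_powser _ _ _ _ _ ar tr hr cv).
  - by rewrite divr_ge0// ltW.
  - by rewrite (gtr0_norm d0) ltr_pdivrMr// ltr_pMr// ltr1n.
move=> y Ay yr; have yr' : `|t - c| + `|y - t| < r.
  by rewrite -ltrBrDl (lt_le_trans yr)// ler_pdivrMr// ler_pMr// ler1n.
apply: recenter_powser ar tr (ltW yr') _.
have E : t - c + (y - t) = y - c by ring.
rewrite E; apply: aru => //; apply: le_lt_trans yr'.
by rewrite -E ler_normD.
Qed.

(** The derivative at [t] is the coefficient of index 1 of the expansion recentred at [t]; as a
    function of [t] this is the termwise derivative. *)
Lemma expands_derive A u c a r :
  (forall t, A t -> ProperFilter (within A t^')) ->
  expands A u c a r ->
  expands A (derive_in A u) c (fun i => i.+1%:R *: a i.+1) (r / 2).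
Proof.
move=> PF Aua; have [r0 ar aru] := Aua; have r20 : 0 < r / 2 by rewrite divr_gt0.
split => //.
  apply: (@series_le_cvg _ _ (fun i => (r / 2)^-1 * (`|a i.+1| * r ^+ i.+1))).
  - by move=> i; rewrite mulr_ge0// exprn_ge0// ltW.
  - by move=> i; rewrite !mulr_ge0 ?invr_ge0 ?exprn_ge0// ltW.
  (* [(i + 1) (r/2)^i (r/2)] is the [j = 1] term in the expansion of [(r/2 + r/2)^(i+1)]. *)
  - move=> i; rewrite ler_pdivlMl//= normrZ normr_nat.
    rewrite [leLHS](_ : _ = `|a i.+1| *
      ('C(i.+1, 1)%:R * (r / 2) ^+ (i.+1 - 1) * (r / 2) ^+ 1)); last first.
      by rewrite bin1 subn1 expr1; ring.
    rewrite ler_wpM2l// [in leRHS](splitr r).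
    by apply: binomial_term_le; rewrite ltW.
  - rewrite (_ : (fun _ => _) = (r / 2)^-1 * r *: (fun i => `|a i.+1| * r ^+ i)).
      by apply: is_cvg_seriesZ; exact: normally_summable_behead.
    by apply/funext => i; rewrite exprS !fctE /GRing.scale/=; ring.
move=> t At tr; have tr' : `|t - c| < r.
  by rewrite (lt_le_trans tr)// ler_pdivrMr// ler_pMr// ler1n.
rewrite (expands_derive_center _ _ _ _ _ (PF t At) At (expands_recenter _ _ _ _ _ _ tr' Aua)).
have := recenter_cvg _ _ _ 1 ar tr'; rewrite -cvg_shiftS.
rewrite (_ : [sequence _]_n = powser (fun i => i.+1%:R *: a i.+1) (t - c))//.
apply/funext => n; rewrite /powser /series/= big_nat_recl//= bin_small//.
rewrite mul0r scale0r add0r; apply: eq_bigr => i _.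
by rewrite bin1 subn1 scalerA mulrC.
Qed.

Lemma expands_deriven A u c a r i :
  (forall t, A t -> ProperFilter (within A t^')) ->
  expands A u c a r ->
  exists r', expands A (deriven_in A i u) c
    (fun j => ((i + j)`!%:R / j`!%:R) *: a (i + j)%N) r'.
Proof.
move=> PF Aua; elim: i => [|i [r' IHi]].
  exists r; rewrite (_ : (fun j => _) = a)//.
  by apply/funext => j; rewrite add0n divff ?scale1r// pnatr_eq0 -lt0n fact_gt0.
exists (r' / 2); rewrite /deriven_in iterS -/(deriven_in A i u).
have := expands_derive _ _ _ _ _ PF IHi.
set b := fun _ => _; rewrite (_ : b = fun j => ((i.+1 + j)`!%:R / j`!%:R) *: a (i.+1 + j)%N)//.
apply/funext => j; rewrite /b addnS addSn scalerA; congr (_ *: _).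
have := fact_gt0 j; rewrite lt0n -(@pnatr_eq0 R) => j0.
rewrite (factS j) natrM invfM mulrCA; congr (_ * _).
by rewrite mulVKf// pnatr_eq0.
Qed.

Lemma expands_deriven_center A u c a r i :
  (forall t, A t -> ProperFilter (within A t^')) -> A c ->
  expands A u c a r -> deriven_in A i u c = i`!%:R *: a i.
Proof.
move=> PF Ac Aua; have [r' /(expands_center _ _ _ _ _ Ac) ->] :=
  expands_deriven _ _ _ _ _ i PF Aua.
by rewrite addn0 fact0 divr1.
Qed.

End Expansions.

(** * Identity theorem and Abel's theorem *)

(** A point below [T] is approached from the right, [T] itself from the left. This makes the limits
    in [derive_in] unique. *)
Lemma within_itv_dnbhs_proper {R : realType} (T t : R) :
  0 < T -> t \in `[0, T] -> ProperFilter (within `[0, T] t^').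
Proof.
move=> T0; rewrite in_itv/= => /andP[t0 tT].
apply: Build_ProperFilter_ex => B /nbhs_ballP[e /= e0 eB].
have [tT'|Tt] := ltP t T.
  exists (t + Num.min (e / 2) (T - t)).
  have m0 : 0 < Num.min (e / 2) (T - t) by rewrite lt_min divr_gt0//= subr_gt0.
  have [m1 m2] : Num.min (e / 2) (T - t) <= e / 2 /\ Num.min (e / 2) (T - t) <= T - t.
    by rewrite !ge_min !lexx orbT.
  apply: eB.
  - rewrite /ball/= opprD addrA subrr add0r normrN gtr0_norm//; lra.
  - by rewrite gt_eqF// ltrDl.
  - by rewrite in_itv/=; apply/andP; split; lra.
exists (t - Num.min (e / 2) T).
have m0 : 0 < Num.min (e / 2) T by rewrite lt_min divr_gt0.
have [m1 m2] : Num.min (e / 2) T <= e / 2 /\ Num.min (e / 2) T <= T.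
  by rewrite !ge_min !lexx orbT.
apply: eB.
- rewrite /ball/= opprB addrC subrK gtr0_norm//; lra.
- by rewrite lt_eqF// gtrBl.
- by rewrite in_itv/=; apply/andP; split; lra.
Qed.

Section IdentityTheorem.
Context {R : realType} {X : completeNormedModType R}.
Implicit Types (a b : nat -> X) (r s h t c : R) (l : X) (A : set R) (u g : R -> X).

Lemma abel_sum_le a (m n : nat) t (e : R) :
  (forall p, `|\sum_(m <= i < p) a i| <= e) -> 0 <= t <= 1 ->
  `|\sum_(m <= i < n) t ^+ i *: a i| <= e.
Proof.
move=> ae /andP[t0 t1]; have e0 : 0 <= e by exact: le_trans (ae 0%N).
have [mn|nm] := leqP m n; last by rewrite big_geq ?normr0// ltnW.
(* Summation by parts makes the sum a combination, with nonnegative weights of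
   total t^m, of the partial sums S p. *)
pose S p := \sum_(m <= i < p) a i.
have -> : \sum_(m <= i < n) t ^+ i *: a i =
    t ^+ n *: S n + \sum_(m <= j < n) (t ^+ j - t ^+ j.+1) *: S j.+1.
  elim: n mn => [|n IHn].
    by rewrite leqn0 => /eqP m0; rewrite /S m0 !big_geq// scaler0 addr0.
  rewrite leq_eqVlt => /orP[/eqP <-|].
    by rewrite /S !big_geq// scaler0 addr0.
  rewrite ltnS => mn.
  rewrite [LHS]big_nat_recr//= IHn// [X in _ = _ + X]big_nat_recr//=.
  have -> : S n.+1 = S n + a n by rewrite /S big_nat_recr.
  rewrite [RHS]addrCA -scalerDl [RHS]addrC [LHS]addrAC; congr (_ + _).
  by rewrite -scalerDr [t ^+ n.+1 + _]addrC subrK.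
have tS j : t ^+ j.+1 <= t ^+ j by rewrite exprS ler_piMl// exprn_ge0.
apply: (@le_trans _ _ (t ^+ m * e)); last first.
  by rewrite ler_piMl// exprn_ile1.
have -> : t ^+ m * e = t ^+ n * e + \sum_(m <= j < n) (t ^+ j - t ^+ j.+1) * e.
  rewrite -mulr_suml -mulrDl; congr (_ * _).
  rewrite (eq_bigr (fun j => - t ^+ j.+1 - - t ^+ j)) => [|j _]; last by ring.
  by rewrite (telescope_sumr (fun j => - t ^+ j))//; ring.
rewrite (le_trans (ler_normD _ _))// lerD//.
  by rewrite normrZ ger0_norm ?ler_wpM2l ?exprn_ge0//; exact: ae.
rewrite (le_trans (ler_norm_sum _ _ _))//; apply: ler_sum => j _.
by rewrite normrZ ger0_norm ?ler_wpM2l ?subr_ge0//; exact: ae.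
Qed.

(** Blocks of the series at 1 starting from [N] have norm at most [e], and [abel_sum_le] carries
    this bound to every [t] in [[0, 1]] with the same [N]. *)
Lemma abel_uniform a l : powser a 1 @ \oo --> l ->
  forall e : R, 0 < e -> exists N, forall t l', 0 <= t <= 1 ->
    powser a t @ \oo --> l' -> `|l' - powser a t N| <= e.
Proof.
move=> al e e0; have e20 : 0 < e / 2 by rewrite divr_gt0.
have /cvgrPdist_le/(_ _ e20)[N _ HN] := al.
exists N => t l' t01 al'; apply: cvg_dist_le al' _; near=> n.
have Nn : (N <= n)%N by near: n; exact: nbhs_infty_ge.
rewrite /powser sub_series_geq//; apply: abel_sum_le => // p.
have [Np|pN] := leqP N p; last by rewrite big_geq ?normr0 ?ltW// ltnW.
have -> : \sum_(N <= i < p) a i = powser a 1 p - powser a 1 N.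
  by rewrite /powser sub_series_geq//; apply: eq_bigr => i _; rewrite expr1n scale1r.
rewrite -(subrKA l) (le_trans (ler_normD _ _))// [leRHS]splitr lerD//.
  by rewrite distrC; exact: HN.
by apply: HN => /=.
Unshelve. all: by end_near. Qed.

(** Letting [h] tend to 0 along the zeros gives [a 0 = 0]; dividing by [h] then leaves the shifted
    series with the same nonzero zeros. *)
Lemma powser_unique a r : 0 < r -> normally_summable a r ->
  (forall d : R, 0 < d -> exists2 h, 0 < `|h| < d & powser a h @ \oo --> (0 : X)) ->
  forall i, a i = 0.
Proof.
move=> r0 ar a0 i.
have center b : normally_summable b r ->
    (forall d : R, 0 < d -> exists2 h, 0 < `|h| < d & powser b h @ \oo --> (0 : X)) ->
    b 0%N = 0.
  move=> br b0; have [K K0 HK] := powser_center _ _ r0 br.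
  apply/eqP; rewrite -normr_le0; apply/ler_addgt0Pr => e e0; rewrite add0r.
  have [|h /andP[_]] := b0 (Num.min r (e / (K + 1))).
    by rewrite lt_min r0 divr_gt0// ltr_wpDl.
  rewrite lt_min => /andP[hr he] /(HK _ _ (ltW hr)).
  rewrite sub0r normrN => /le_trans; apply.
  rewrite (le_trans (ler_wpM2l K0 (ltW he)))// mulrCA ger_pMr//.
  by rewrite ler_pdivrMr ?mul1r ?lerDl// ltr_wpDl.
elim: i a ar a0 => [|i IHi] a ar a0; first exact: center.
apply: (IHi (fun i => a i.+1)); first exact: normally_summable_behead.
move=> d /a0[h hd ah]; exists h => //.
have h0 : h != 0 by rewrite -normr_gt0; case/andP: hd.
by have := powser_behead _ _ _ h0 ah; rewrite (center a)// subrr scaler0.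
Qed.

Lemma powserB a b h : powser (fun i => a i - b i) h = powser a h - powser b h.
Proof.
apply/funext => n; rewrite /powser /series/= !fctE -sumrB; apply: eq_bigr => i _.
by rewrite scalerBr.
Qed.

Lemma normally_summableB a b r : 0 <= r ->
  normally_summable a r -> normally_summable b r ->
  normally_summable (fun i => a i - b i) r.
Proof.
move=> r0 ar br; apply: series_le_cvg (is_cvg_seriesD ar br) => i.
- by rewrite mulr_ge0// exprn_ge0.
- by rewrite addr_ge0// mulr_ge0// exprn_ge0.
- by rewrite -mulrDl ler_wpM2r ?exprn_ge0// ler_normB.
Qed.

(* The supremum of the initial segments on which the expansion at 0 is valid
   cannot be interior: recentred there, the series and the local expansion of g
   agree on one side, hence coefficientwise, hence also on the other side. *)
Lemma powser_extension g a r :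
  (forall t, t \in `[0, 1] -> exists b s, expands [set` `[0, 1]] g t b s) ->
  expands [set` `[0, 1]] g 0 a r -> cvgn (powser a 1) ->
  forall t, 0 <= t < 1 -> powser a t @ \oo --> g t.
Proof.
move=> gan [r0 _ ag] a1 t t01; apply: contrapT => nt.
have asum s : 0 <= s < 1 -> normally_summable a s.
  by move=> /andP[s0 s1]; apply: powser_normally_summable a1 s0 _; rewrite normr1.
pose E := [set s | 0 <= s < 1 /\
  forall y, 0 <= y <= s -> powser a y @ \oo --> g y].
have E0 : E (Num.min (r / 2) 2^-1).
  split=> [|y /andP[y0]]; first by rewrite le_min !divr_ge0 ?ltW//= gt_min invf_lt1 ?ltr1n ?orbT.
  rewrite le_min => /andP[yr y2]; have := ag y; rewrite subr0; apply.
    by rewrite /= in_itv/= y0; lra.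
  by rewrite ger0_norm//; lra.
(* Failure at [t] caps [E], which forces its supremum below 1. *)
have ubE : ubound E t.
  move=> s [_ sE]; rewrite leNgt; apply/negP => ts.
  by apply: nt; apply: sE; rewrite (ltW ts) andbT; case/andP: t01.
have supE : has_sup E by split; [exists (Num.min (r / 2) 2^-1)|exists t].
pose w := sup E.
have w0 : 0 < w.
  apply: lt_le_trans (ub_le_sup _ E0); last by exists t.
  by rewrite lt_min divr_gt0//= invr_gt0.
have w1 : w < 1 by apply: le_lt_trans (ge_sup _ ubE) _; [case: supE|case/andP: t01].
have aw y : 0 <= y < w -> powser a y @ \oo --> g y.
  move=> /andP[y0 yw]; have [s [_ sE] ys] := sup_gt (let: conj P _ := supE in P) yw.
  by apply: sE; rewrite y0 ltW.
have [b [s [s0 bs bg]]] : exists b s, expands [set` `[0, 1]] g w b s.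
  by apply: gan; rewrite in_itv/= !ltW.
pose v := (w + 1) / 2; have [v0 wv v1] : [/\ 0 <= v, w < v & v < 1].
  by rewrite /v; split; lra.
have av : normally_summable a v by apply: asum; rewrite v0.
(* For [|h| < d], the bound [s] keeps [w + h] within the local expansion, [w] keeps it positive, and
   [(v - w) / 2] keeps it below [v], where [a] is normally summable. *)
pose d := Num.min (Num.min s w) ((v - w) / 2).
have d0 : 0 < d by rewrite !lt_min s0 w0 divr_gt0 ?subr_gt0.
have [ds dw dv] : [/\ d <= s, d <= w & d <= (v - w) / 2].
  by rewrite /d !ge_min !lexx !orbT.
have nw : `|w| = w by rewrite ger0_norm// ltW.
have cS h : `|h| < d -> powser (recenter a w) h @ \oo --> limn (powser a (w + h)).
  move=> hd; apply: (recenter_powser _ _ _ _ _ av); rewrite ?nw//; first by lra.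
  apply: normally_summable_cvg av _; rewrite (le_trans (ler_normD _ _))// nw; lra.
(* Normal summability at [d / 2] needs convergence at a strictly larger point, here
   [2 d / 3 < d]. *)
have asd : normally_summable (recenter a w) (d / 2).
  apply: (@powser_normally_summable _ _ _ (d * 2 / 3)).
  - apply: cvgP; apply: cS; rewrite gtr0_norm; lra.
  - lra.
  - rewrite gtr0_norm; lra.
have dE : forall i, recenter a w i - b i = 0.
  apply: (@powser_unique _ (d / 2)); first by rewrite divr_gt0.
    apply: normally_summableB => //; first by lra.
    by apply: normally_summable_le bs; lra.
  (* A negative [h] places [w + h] to the left of [w], where both series are known to sum to [g]. *)
  move=> e e0; pose h := - Num.min (e / 2) (d / 2).
  have [h1 h2 h3] : [/\ h < 0, - h <= e / 2 & - h <= d / 2].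
    by rewrite /h opprK oppr_lt0 lt_min !divr_gt0// !ge_min !lexx orbT.
  have nh : `|h| = - h by rewrite ltr0_norm.
  exists h; first by rewrite nh; apply/andP; split; lra.
  have hd : `|h| < d by rewrite nh; lra.
  have wh : 0 <= w + h < w by apply/andP; split; lra.
  rewrite powserB -(subrr (g (w + h))); apply: cvgB.
    by have := cS _ hd; rewrite (cvg_lim _ (aw _ wh)).
  have wK : w + h - w = h by ring.
  have := bg (w + h); rewrite wK; apply; last by lra.
  by rewrite /= in_itv/=; apply/andP; split; lra.
(* With equal coefficients, the expansion of [g] at [w] carries the identity past the supremum, a
   contradiction. *)
have Ed : E (w + d / 2).
  split; first by apply/andP; split; lra.
  move=> y /andP[y0 yd]; have [yw|wy] := ltP y w; first by apply: aw; rewrite y0.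
  have hd : `|y - w| < d by rewrite ger0_norm; lra.
  have cv : cvgn (powser a y).
    by apply: normally_summable_cvg av _; rewrite ger0_norm; lra.
  have := cS _ hd; rewrite (addrC w) subrK.
  rewrite (_ : recenter a w = b); last first.
    by apply/funext => i; apply/eqP; rewrite -subr_eq0 dE.
  move=> cb; have cg : powser b (y - w) @ \oo --> g y.
    by apply: bg; [rewrite /= in_itv/= y0; lra|exact: lt_le_trans ds].
  by rewrite -(cvg_unique _ cb cg).
by have := ub_le_sup (ex_intro _ t ubE) Ed; rewrite -/w; lra.
Qed.

End IdentityTheorem.

(** * The sum of a convergent Taylor series on [[0, T]] *)

Section Taylor.
Context {R : realType} {X : completeNormedModType R}.
Implicit Types (a b : nat -> X) (r s h t c : R) (l : X) (A : set R) (u g : R -> X).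

Lemma powser_continuous a n : continuous (fun t => powser a t n).
Proof.
apply: continuous_big => [|i _]; first exact: add_continuous.
by move=> t; apply: cvgZr_tmp; exact: exprn_continuous.
Qed.

(** Four errors of [e / 4]: Abel's estimate at 1 and at [t], continuity of the [N]-th partial sum,
    and continuity of [g] at 1 from its local expansion there. *)
Lemma powser_extension_endpoint g a r :
  (forall t, t \in `[0, 1] -> exists b s, expands [set` `[0, 1]] g t b s) ->
  expands [set` `[0, 1]] g 0 a r -> cvgn (powser a 1) ->
  powser a 1 @ \oo --> g 1.
Proof.
move=> gan ag a1; suff <- : limn (powser a 1) = g 1 by [].
have ext := powser_extension _ _ _ gan ag a1.
have i1 : 1 \in `[0, 1 : R] by rewrite in_itv/= ler01 lexx.
have [b [s gb]] := gan 1 i1; have [s0 bs bg] := gb.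
have [K K0 HK] := powser_center _ _ s0 bs.
have b0 : g 1 = b 0%N := expands_center _ _ _ _ _ i1 gb.
apply/eqP; rewrite -subr_eq0 -normr_le0; apply/ler_addgt0Pr => e e0; rewrite add0r.
have e40 : 0 < e / 4 by rewrite divr_gt0.
have [N HN] := abel_uniform _ _ a1 _ e40.
have /cvgrPdist_le/(_ _ e40) cont : powser a t N @[t --> 1^'-] --> powser a 1 N.
  by apply: cvg_at_left_filter; exact: powser_continuous.
near (1 : R)^'- => t.
have t1 : t < 1 by near: t; exact: nbhs_left_lt.
have t0 : 0 < t by near: t; exact: nbhs_left_gt.
have ts : 1 - s < t by near: t; apply: nbhs_left_gt; rewrite ltrBlDr ltrDl.
have tK : 1 - e / 4 / (K + 1) < t.
  by near: t; apply: nbhs_left_gt; rewrite ltrBlDr ltrDl divr_gt0// ltr_wpDl.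
have gt : powser a t @ \oo --> g t by apply: ext; rewrite ltW.
have Et : `|powser a 1 N - powser a t N| <= e / 4 by near: t.
have E1 : `|limn (powser a 1) - powser a 1 N| <= e / 4.
  by apply: HN a1; rewrite ler01 lexx.
have E2 : `|g t - powser a t N| <= e / 4.
  by apply: HN gt; rewrite !ltW.
have nt : `|t - 1| = 1 - t by rewrite ltr0_norm ?subr_lt0// opprB.
have E3 : `|g t - g 1| <= e / 4.
  rewrite b0; apply: le_trans (HK (t - 1) _ _ (bg _ _ _)) _.
  - by rewrite nt; lra.
  - by rewrite /= in_itv/= !ltW.
  - by rewrite nt; lra.
  rewrite nt; apply: (@le_trans _ _ (K * (e / 4 / (K + 1)))).
    by apply: ler_wpM2l => //; lra.
  by rewrite mulrCA ger_pMr// ler_pdivrMr ?mul1r ?lerDl// ltr_wpDl.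
have -> : limn (powser a 1) - g 1 = (limn (powser a 1) - powser a 1 N) +
    (powser a 1 N - powser a t N) - (g t - powser a t N) + (g t - g 1).
  by rewrite opprB addrA -[RHS]addrA subrKA subrKA; rewrite addrA subrK.
rewrite (le_trans (ler_normD _ _))//; have := ler_normB (limn (powser a 1) - powser a 1 N +
  (powser a 1 N - powser a t N)) (g t - powser a t N).
have := ler_normD (limn (powser a 1) - powser a 1 N) (powser a 1 N - powser a t N).
lra.
Unshelve. all: by end_near. Qed.

(** Convergence at one point [y] of [A] near and distinct from [c] gives normal summability at half
    the distance. *)
Lemma analytic_expands A u c : ProperFilter (within A c^') -> A c ->
  analytic_on A u -> exists a r, expands A u c a r.
Proof.
move=> PF Ac /(_ c Ac)[a /nbhs_ballP[e /= e0 eP]].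
have near_c : within A c^' (ball c e).
  by apply: (filterS _ (dnbhs_ball c e0)) => y [yc _] _.
near (within A c^') => y.
have Ay : A y by near: y; exact: withinT.
have yc : y != c.
  by near: y; apply: (filterS _ (nbhs_dnbhs_neq c)) => y yc _.
have ye : ball c e y by near: y.
have yc0 : 0 < `|y - c| by rewrite normr_gt0 subr_eq0.
exists a, (`|y - c| / 2); split; first by rewrite divr_gt0.
  apply: (@powser_normally_summable _ _ _ (y - c)).
  - by apply: cvgP; exact: eP ye Ay.
  - by rewrite divr_ge0.
  - by lra.
move=> t At tr; apply: eP => //=; rewrite /ball/= distrC.
apply: lt_trans ye; rewrite (distrC c); lra.
Unshelve. all: by end_near. Qed.

Lemma powser_scale a (w h : R) :
  powser (fun i => w ^+ i *: a i) h = powser a (h * w).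
Proof.
apply/funext => n; apply: eq_bigr => i _.
by rewrite scalerA exprMn.
Qed.

(** Parametrising the segment from [c] to [x] by [[0, 1]] treats both sides of [c] alike; the added
    1 keeps the divisor positive when [x = c]. *)
Lemma expands_comp_affine u T c x t a r :
  c \in `[0, T] -> x \in `[0, T] ->
  expands [set` `[0, T]] u (c + t * (x - c)) a r ->
  expands [set` `[0, 1]] (fun y => u (c + y * (x - c))) t
    (fun i => (x - c) ^+ i *: a i) (r / (`|x - c| + 1)).
Proof.
rewrite !in_itv/= => /andP[c0 cT] /andP[x0 xT] [r0 ar aru].
have w0 : 0 < `|x - c| + 1 by rewrite ltr_wpDl.
split; first by rewrite divr_gt0.
  apply: series_le_cvg ar => i.
  - by rewrite mulr_ge0// exprn_ge0// divr_ge0// ltW.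
  - by rewrite mulr_ge0// exprn_ge0// ltW.
  - rewrite normrZ normrX mulrAC mulrC ler_wpM2l// -exprMn lerXn2r ?nnegrE//.
    + by rewrite mulr_ge0// divr_ge0// ltW.
    + exact: ltW.
    + by rewrite mulrCA ger_pMr// ler_pdivrMr ?mul1r ?lerDl.
move=> y; rewrite /= in_itv/= => /andP[y0 y1] yr.
have E : c + y * (x - c) - (c + t * (x - c)) = (y - t) * (x - c) by ring.
rewrite powser_scale -E; apply: aru.
  by rewrite /= in_itv/=; apply/andP; split; nra.
rewrite E normrM; move: yr; rewrite ltr_pdivlMr//; apply: le_lt_trans.
by rewrite ler_wpM2l// lerDl.
Qed.

Lemma taylor_cvg_value (T : R) u c x : 0 < T ->
  analytic_on [set` `[0, T]] u -> c \in `[0, T] -> x \in `[0, T] ->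
  taylor_cvg [set` `[0, T]] u c x ->
  series (fun i => ((x - c) ^+ i / i`!%:R) *: deriven_in [set` `[0, T]] i u c)
    @ \oo --> u x.
Proof.
move=> T0 uan cT xT.
have PF t : [set` `[0, T]] t -> ProperFilter (within [set` `[0, T]] t^').
  exact: within_itv_dnbhs_proper.
have exps t : t \in `[0, T] -> exists a r, expands [set` `[0, T]] u t a r.
  by move=> tT; apply: analytic_expands => //; exact: PF.
have [a [r ua]] := exps c cT.
(* As the [i]-th derivative at [c] is [i! a_i], the Taylor series at [x] is the segment's power
   series at parameter 1. *)
rewrite /taylor_cvg (_ : series _ = powser (fun i => (x - c) ^+ i *: a i) 1).
  have ext := powser_extension_endpoint (fun y => u (c + y * (x - c)))
    (fun i => (x - c) ^+ i *: a i) (r / (`|x - c| + 1)).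
  have uE : u x = u (c + 1 * (x - c)) by rewrite mul1r addrC subrK.
  rewrite uE; apply: ext => [t t01|].
    have : c + t * (x - c) \in `[0, T].
      move: cT xT t01; rewrite !in_itv/= => /andP[? ?] /andP[? ?] /andP[? ?].
      by apply/andP; split; nra.
    by move=> /exps[b [s ub]]; do 2 eexists; exact: expands_comp_affine ub.
  by apply: (expands_comp_affine _ T) => //; rewrite mul0r addr0.
apply/funext => n; apply: eq_bigr => i _.
rewrite (expands_deriven_center _ _ _ _ _ i PF cT ua) expr1n scale1r scalerA.
by rewrite mulfVK// pnatr_eq0 -lt0n fact_gt0.
Qed.

End Taylor.

(** * Taylor expansions of finite differences *)

Section TaylorDifferences.
Context {R : realType} {X : completeNormedModType R}.
Implicit Types (F G : nat -> X) (L D : X).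

(** Brings a full series into the shape of the expansions: vanishing terms, a leading term at index
    [p], then the remainder. *)
Lemma series_cvg_tail F G (p : nat) D L :
  (forall i, (i < p)%N -> F i = 0) -> F p = D ->
  (forall i, (p < i)%N -> F i = G i) ->
  series F @ \oo --> L -> D + \sum_(p.+1 <= i < M) G i @[M --> \oo] --> L.
Proof.
move=> F0 FD FG; apply: cvg_trans; apply: near_eq_cvg; near=> M.
have pM : (p < M)%N by near: M; exact: nbhs_infty_gt.
rewrite /series/= (@big_cat_nat _ _ _ p)//=; last exact: ltnW.
rewrite big_nat big1 => [|i /andP[_ /F0]//]; rewrite add0r big_ltn// FD.
by congr (_ + _); apply: eq_big_nat => i /andP[pi _]; rewrite FG.
Unshelve. all: by end_near. Qed.

Lemma series_double F M :
  series F (2 * M)%N = \sum_(0 <= i < M) (F (2 * i)%N + F (2 * i + 1)%N).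
Proof.
elim: M => [|M IHM]; first by rewrite /series/= !big_geq.
by rewrite mulnS addSn add1n !seriesSr IHM big_nat_recr//= addn1 addrA.
Qed.

(** Pairing terms passes to the partial sums of even length; in the centred cases parity then kills
    one term of each later pair. *)
Lemma series_cvg_double F L : series F @ \oo --> L ->
  series (fun i => F (2 * i)%N + F (2 * i + 1)%N) @ \oo --> L.
Proof.
move=> FL; rewrite (_ : series _ = series F \o (fun M => 2 * M)%N).
  apply: cvg_comp FL; apply: cvg_mulnl.
  by [].
by apply/funext => M; exact/esym/series_double.
Qed.

(** The last equation puts the rightmost node at index [q + p], so exactly the nodes [q] to [q + p]
    occur; their Taylor series are combined by exchanging finite sums. *)
Lemma fdiff_nodes_cvg (T k : R) (u : R -> X) (N p q : nat) (c s : R) :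
  0 < k -> (0 < N)%N -> node k N = T -> analytic_on [set` `[0, T]] u ->
  c \in `[0, T] -> (q + p <= N)%N -> taylor_cvg_nodes T u k c q (q + p) ->
  c + s * k = node k (q + p) ->
  series (fun i => (k ^+ i / k ^+ p / i`!%:R * altsum p i s) *:
    deriven_in [set` `[0, T]] i u c) @ \oo --> fdiff k p s u c.
Proof.
move=> k0 N0 NT uan cT qpN cvT csE.
have T0 : 0 < T by rewrite -NT /node mulr_gt0// ltr0n.
have cx (j : nat) : (j <= p)%N -> c + (s - j%:R) * k = node k (q + p - j).
  move=> jp; rewrite mulrBl addrA csE /node natrB; first by ring.
  by lia.
have val (j : nat) : (j <= p)%N ->
    series (fun i => (((s - j%:R) * k) ^+ i / i`!%:R) *:
      deriven_in [set` `[0, T]] i u c) @ \oo --> u (c + (s - j%:R) * k).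
  move=> jp; have xE : c + (s - j%:R) * k - c = (s - j%:R) * k by ring.
  rewrite -{1}xE cx//; apply: taylor_cvg_value => //.
    rewrite -NT in_itv/= /node mulr_ge0 ?(ltW k0)//= ler_pM2r// ler_nat; lia.
  by apply: cvT; lia.
rewrite /fdiff big_mkord.
have : k ^- p *: (\sum_(j < p.+1) ((-1) ^+ j * 'C(p, j)%:R) *: series (fun i =>
      (((s - j%:R) * k) ^+ i / i`!%:R) *: deriven_in [set` `[0, T]] i u c) M)
    @[M --> \oo] --> k ^- p *: \sum_(j < p.+1)
      ((-1) ^+ j * 'C(p, j)%:R) *: u (c + (s - j%:R) * k).
  apply: cvgZl_tmp; apply: cvg_big => [|j _]; first exact: add_continuous.
  by apply: cvgZl_tmp; apply: val; rewrite -ltnS.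
apply: cvg_trans; apply: near_eq_cvg; near=> M; rewrite /series/=.
under eq_bigr do rewrite scaler_sumr.
rewrite exchange_big scaler_sumr/=; apply: eq_bigr => i _.
rewrite scaler_sumr /altsum big_mkord mulr_sumr scaler_suml; apply: eq_bigr => j _.
by rewrite !scalerA exprMn; congr (_ *: _); ring.
Unshelve. all: by end_near. Qed.

End TaylorDifferences.

(** * The six expansions, by choice of order, offset and node range *)

Theorem theorem3 (R : realType) (X : completeNormedModType R) (T : R)
    (u : R -> X) (hu : analytic_on `[0, T] u)
    (k : R) (hk : 0 < k) (N : nat) (hN : (0 < N)%N) (hT : node k N = T)
    (m : nat) (hm : (0 < m)%N) (n : nat) :
  ((n + m <= N)%N ->
   taylor_cvg_nodes T u k (node k n) n (n + m) ->
   deriven_in `[0, T] m u (node k n) +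
     \sum_(m.+1 <= i < M)
       (k ^+ (i - m) / i`!%:R * altsum m i m%:R)
         *: deriven_in `[0, T] i u (node k n)
     @[M --> \oo] --> iter m (Dplus k) u (node k n))
  /\
  ((m <= n <= N)%N ->
   taylor_cvg_nodes T u k (node k n) (n - m) n ->
   deriven_in `[0, T] m u (node k n) +
     \sum_(m.+1 <= i < M)
       (k ^+ (i - m) / i`!%:R * altsum m i 0)
         *: deriven_in `[0, T] i u (node k n)
     @[M --> \oo] --> iter m (Dminus k) u (node k n))
  /\
  ((m.+1 <= n)%N -> (n + m <= N)%N ->
   taylor_cvg_nodes T u k (node k n) (n - m.+1) (n + m) ->
   deriven_in `[0, T] (2 * m + 1) u (node k n) +
     \sum_(2 * m + 2 <= i < M)
       (k ^+ (i - (2 * m + 1)) / i`!%:R * altsum (2 * m + 1) i m%:R)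
         *: deriven_in `[0, T] i u (node k n)
     @[M --> \oo] --> Dminus k (Dpm k m u) (node k n))
  /\
  ((m <= n)%N -> (n + m <= N)%N ->
   taylor_cvg_nodes T u k (node k n) (n - m) (n + m) ->
   deriven_in `[0, T] (2 * m) u (node k n) +
     \sum_(m.+1 <= i < M)
       (k ^+ (2 * i - 2 * m) / (2 * i)`!%:R * altsum (2 * m) (2 * i) m%:R)
         *: deriven_in `[0, T] (2 * i) u (node k n)
     @[M --> \oo] --> Dpm k m u (node k n))
  /\
  ((m <= n)%N -> (n + m.+1 <= N)%N ->
   taylor_cvg_nodes T u k (hnode k n) (n - m) (n + m.+1) ->
   deriven_in `[0, T] (2 * m + 1) u (hnode k n) +
     \sum_(m.+1 <= i < M)
       (k ^+ (2 * i - 2 * m) / (2 * i + 1)`!%:R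
          * altsum (2 * m + 1) (2 * i + 1) (m%:R + 2^-1))
         *: deriven_in `[0, T] (2 * i + 1) u (hnode k n)
     @[M --> \oo] --> Dmid k (Dpm k m u) (hnode k n))
  /\
  ((m <= n)%N -> (n + m.+1 <= N)%N ->
   taylor_cvg_nodes T u k (hnode k n) (n - m) (n + m.+1) ->
   deriven_in `[0, T] (2 * m) u (hnode k n) +
     \sum_(m.+1 <= i < M)
       (2^-1 * (\sum_(0 <= j < (2 * m).+1) (-1) ^+ j * 'C(2 * m, j)%:R *
                  ((m%:R - j%:R + 2^-1) ^+ (2 * i)
                   + (m%:R - j%:R - 2^-1) ^+ (2 * i)))
          * (k ^+ (2 * i - 2 * m) / (2 * i)`!%:R))
         *: deriven_in `[0, T] (2 * i) u (hnode k n)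
     @[M --> \oo] --> Emid k (Dpm k m u) (hnode k n)).
Proof.
have k0 : k != 0 by rewrite gt_eqF.
have kX p i : (p < i)%N -> k ^+ i / k ^+ p = k ^+ (i - p).
  by move=> pi; rewrite expfB.
have diag p : k ^+ p / k ^+ p / p`!%:R * p`!%:R = 1 :> R.
  by rewrite divff ?expf_neq0// mul1r mulVf// pnatr_eq0 -lt0n fact_gt0.
have nodeT l : (l <= N)%N -> node k l \in `[0, T].
  move=> lN; rewrite -hT in_itv/= /node mulr_ge0 ?(ltW hk)//= ler_pM2r//.
  by rewrite ler_nat.
have hnodeT l : (l < N)%N -> hnode k l \in `[0, T].
  move=> lN; have l0 : 0 <= l%:R + 2^-1 :> R by rewrite addr_ge0 ?invr_ge0.
  have lN1 : l%:R + 1 <= N%:R :> R by rewrite natr1 ler_nat.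
  rewrite -hT in_itv/= /node /hnode (mulr_ge0 l0 (ltW hk))/= ler_pM2r//.
  by lra.
split; [|split; [|split; [|split; [|split]]]].
- move=> nmN cv; rewrite iter_Dplus.
  apply: (series_cvg_tail _ _ _ _ _ _ _ _
    (@fdiff_nodes_cvg _ _ T k u N m n _ _ hk hN hT hu _ _ cv _)) => //.
  + by move=> i im; rewrite altsum_small// mulr0 scale0r.
  + by rewrite altsum_diag diag scale1r.
  + by move=> i mi; rewrite kX.
  + by apply: nodeT; lia.
  + by rewrite /node natrD; ring.
- move=> /andP[mn nN] cv; rewrite iter_Dminus.
  have qp : (n - m + m = n)%N by lia.
  rewrite -{3}qp in cv.
  apply: (series_cvg_tail _ _ _ _ _ _ _ _
    (@fdiff_nodes_cvg _ _ T k u N m (n - m) _ _ hk hN hT hu _ _ cv _)) => //.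
  + by move=> i im; rewrite altsum_small// mulr0 scale0r.
  + by rewrite altsum_diag diag scale1r.
  + by move=> i mi; rewrite kX.
  + exact: nodeT.
  + by lia.
  + by rewrite qp mul0r addr0.
- move=> mn nN cv; rewrite Dminus_Dpm.
  have qp : (n - m.+1 + (2 * m + 1) = n + m)%N by lia.
  rewrite -qp in cv; rewrite (_ : (2 * m + 2 = (2 * m + 1).+1)%N); last by lia.
  apply: (series_cvg_tail _ _ _ _ _ _ _ _
    (@fdiff_nodes_cvg _ _ T k u N (2 * m + 1) (n - m.+1) _ _ hk hN hT hu _ _ cv _)) => //.
  + by move=> i im; rewrite altsum_small// mulr0 scale0r.
  + by rewrite altsum_diag diag scale1r.
  + by move=> i mi; rewrite kX.
  + by apply: nodeT; lia.
  + by lia.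
  + by rewrite qp /node natrD; ring.
- move=> mn nN cv; rewrite Dpm_fdiff.
  have qp : (n - m + (2 * m) = n + m)%N by lia.
  (* The offset [m] is half the order [2m], so parity removes the odd derivatives. *)
  have oddZ i : odd i -> altsum (2 * m) i m%:R = 0 :> R.
    rewrite (_ : m%:R = (2 * m)%:R / 2 :> R); last by rewrite natrM; field.
    by move=> oi; rewrite altsum_parity//; lia.
  rewrite -qp in cv.
  apply: (series_cvg_tail _ _ _ _ _ _ _ _ (series_cvg_double _ _
    (@fdiff_nodes_cvg _ _ T k u N (2 * m) (n - m) _ m%:R hk hN hT hu _ _ cv _))) => //.
  + move=> i im; rewrite !altsum_small ?mulr0 ?scale0r ?addr0//; lia.
  + by rewrite altsum_diag diag scale1r (oddZ (2 * m + 1)%N) ?mulr0 ?scale0r ?addr0//; lia.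
  + by move=> i mi; rewrite (oddZ (2 * i + 1)%N) ?mulr0 ?scale0r ?addr0 ?kX//; lia.
  + by apply: nodeT; lia.
  + by lia.
  + by rewrite qp /node natrD; ring.
- move=> mn nN cv; rewrite Dmid_Dpm.
  have qp : (n - m + (2 * m + 1) = n + m.+1)%N by lia.
  (* The offset [m + 1/2] is half the odd order [2m + 1], so the even derivatives are the ones
     removed. *)
  have evenZ i : ~~ odd i -> altsum (2 * m + 1) i (m%:R + 2^-1) = 0 :> R.
    rewrite (_ : m%:R + 2^-1 = (2 * m + 1)%:R / 2 :> R); last first.
      by rewrite natrD natrM; field.
    by move=> oi; rewrite altsum_parity//; lia.
  rewrite -qp in cv.
  apply: (series_cvg_tail _ _ _ _ _ _ _ _ (series_cvg_double _ _
    (@fdiff_nodes_cvg _ _ T k u N (2 * m + 1) (n - m) _ (m%:R + 2^-1) hk hN hT hu _ _ cv _))) => //.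
  + move=> i im; rewrite !altsum_small ?mulr0 ?scale0r ?addr0//; lia.
  + by rewrite altsum_diag diag scale1r (evenZ (2 * m)%N) ?mulr0 ?scale0r ?add0r//; lia.
  + move=> i mi; rewrite (evenZ (2 * i)%N) ?mulr0 ?scale0r ?add0r ?kX//; try lia.
    by congr (_ ^+ _ / _ * _ *: _); lia.
  + by apply: hnodeT; lia.
  + by lia.
  + by rewrite qp /node /hnode natrD -(natr1 m); field.
- move=> mn nN cv; rewrite Emid_Dpm.
  have qp1 : (n - m + 2 * m = n + m)%N by lia.
  have qp2 : ((n - m).+1 + 2 * m = n + m.+1)%N by lia.
  (* The reflection [s -> 2m - s] exchanges the offsets [m + 1/2] and [m - 1/2], so odd terms cancel
     in the average. *)
  have odd0 i : odd i -> altsum (2 * m) i (m%:R + 2^-1) +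
      altsum (2 * m) i (m%:R - 2^-1) = 0 :> R.
    move=> oi; rewrite [X in _ + altsum _ _ X](_ : _ = (2 * m)%:R - (m%:R + 2^-1)).
      by rewrite altsum_reflect -signr_odd oddD oddM/= oi expr1 mulN1r subrr.
    by rewrite natrM; field.
  have avgE i : \sum_(0 <= j < (2 * m).+1) (-1) ^+ j * 'C(2 * m, j)%:R *
      ((m%:R - j%:R + 2^-1) ^+ i + (m%:R - j%:R - 2^-1) ^+ i) =
      altsum (2 * m) i (m%:R + 2^-1) + altsum (2 * m) i (m%:R - 2^-1) :> R.
    rewrite /altsum -big_split; apply: eq_bigr => j _.
    by rewrite mulrDr; congr (_ * _ ^+ _ + _ * _ ^+ _); ring.
  have hnT : hnode k n \in `[0, T] by apply: hnodeT; lia.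
  (* The two halves of the average use the nodes [n - m + 1] to [n + m + 1] and [n - m] to
     [n + m]. *)
  have cvp : series (fun i => (k ^+ i / k ^+ (2 * m) / i`!%:R *
      altsum (2 * m) i (m%:R + 2^-1)) *: deriven_in [set` `[0, T]] i u (hnode k n))
      @ \oo --> fdiff k (2 * m) (m%:R + 2^-1) u (hnode k n).
    apply: (@fdiff_nodes_cvg _ _ T k u N (2 * m) (n - m).+1) => //; first lia.
      by move=> l /andP[l1 l2]; apply: cv; lia.
    by rewrite qp2 /node /hnode natrD -(natr1 m); field.
  have cvm : series (fun i => (k ^+ i / k ^+ (2 * m) / i`!%:R *
      altsum (2 * m) i (m%:R - 2^-1)) *: deriven_in [set` `[0, T]] i u (hnode k n))
      @ \oo --> fdiff k (2 * m) (m%:R - 2^-1) u (hnode k n).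
    apply: (@fdiff_nodes_cvg _ _ T k u N (2 * m) (n - m)) => //; first lia.
      by move=> l /andP[l1 l2]; apply: cv; lia.
    by rewrite qp1 /node /hnode natrD; field.
  have cvpm : series (fun i => (k ^+ i / k ^+ (2 * m) / i`!%:R *
      (2^-1 * (altsum (2 * m) i (m%:R + 2^-1) + altsum (2 * m) i (m%:R - 2^-1))))
      *: deriven_in [set` `[0, T]] i u (hnode k n))
      @ \oo --> 2^-1 *: (fdiff k (2 * m) (m%:R + 2^-1) u (hnode k n) +
                         fdiff k (2 * m) (m%:R - 2^-1) u (hnode k n)).
    apply: (cvg_trans _ (cvgZl_tmp (k := 2^-1) (cvgD cvp cvm))).
    apply: near_eq_cvg; near=> M.
    rewrite !fctE /series/= -big_split scaler_sumr; apply: eq_bigr => i _.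
    by rewrite /= -scalerDl scalerA; congr (_ *: _); ring.
  apply: (series_cvg_tail _ _ _ _ _ _ _ _ (series_cvg_double _ _ cvpm)).
  + by move=> i im; rewrite !altsum_small ?addr0 ?mulr0 ?scale0r ?addr0//; lia.
  + rewrite (odd0 (2 * m + 1)%N) ?mulr0 ?scale0r ?addr0//; last lia.
    rewrite !altsum_diag (_ : 2^-1 * _ = (2 * m)`!%:R); last by field.
    by rewrite diag scale1r.
  + move=> i mi; rewrite (odd0 (2 * i + 1)%N) ?mulr0 ?scale0r ?addr0//; last lia.
    by rewrite avgE kX; [congr (_ *: _); rewrite mulrC|lia].
Unshelve. all: by end_near. Qed.
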